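(* Let $(0,0)$ be an isolated singular point of the system $$\dot x=y+A(x,y),\qquad \dot y=B(x,y), \qquad (\ast)$$ where $A,B$ are analytic in a neighborhood of $(0,0)$ with zero $1$-jets at $(0,0)$, let $y=f(x)$ be the solution of $y+A(x,y)=0$ near $(0,0)$, and suppose $F(x)=B(x,f(x))=ax^m+\mathcal{O}(x^{m+1})$ and $G(x)=\big(\frac{\partial A}{\partial x}+\frac{\partial B}{\partial y}\big)(x,f(x))=bx^n+\mathcal{O}(x^{n+1})$ with $m\in\mathbb{N}$, $m\ge1$, $a\ne0$. Let $(\ast\ast)$ denote the system $$\dot u=\sum_{k=1}^\infty\varphi_k(u)v^k,\qquad \dot v=\sum_{k=0}^\infty\psi_k(u)v^k,$$ obtained from $(\ast)$ by the change of coordinates $u=x$, $v=y-f(x)$, which transforms the characteristic curve $y=f(x)$ into $v=0$. Let $C_{h1}$ be the characteristic map of system $(\ast)$ with characteristic curve $y=f(x)$, and let $C_{h2}$ be the characteristic map of system $(\ast\ast)$ with characteristic curve $v=0$. Then $C_{h1}(x)=C_{h2}(x)$.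
   Context: Here, with $X(x,y)=y+A(x,y)$ and $Y(x,y)=B(x,y)$, $$\varphi_k(x)=\frac1{k!}\frac{\partial^kX}{\partial y^k}\Big|_{y=f(x)},\qquad \psi_k(x)=\frac1{k!}\Big(\frac{\partial^kY}{\partial y^k}-f'(x)\frac{\partial^kX}{\partial y^k}\Big)\Big|_{y=f(x)}.$$ The unit-time map $U=(U_1,U_2)$ of a planar system is the time-one map $\phi_1$ of its flow, near the origin. The characteristic map of a planar system with nilpotent singularity at the origin and characteristic curve $y=f(x)$ is the one-dimensional map $C_h(x)=U_1(x,f(x))$. *)

(* Defs.v *)
From Stdlib Require Import Reals Factorial ClassicalEpsilon.
From Coquelicot Require Import Coquelicot.
Open Scope R_scope.

(** Sum of an absolutely convergent double power series on a square around
    (x0, y0), with the terms grouped by total degree. *)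
Definition analytic2_at (H : R -> R -> R) (x0 y0 : R) : Prop :=
  exists (c : nat -> nat -> R) (r : posreal),
    forall x y, Rabs (x - x0) < r -> Rabs (y - y0) < r ->
      let term i j := c i j * (x - x0) ^ i * (y - y0) ^ j in
      ex_series (fun d => sum_n (fun i => Rabs (term i (d - i)%nat)) d) /\
      is_series (fun d => sum_n (fun i => term i (d - i)%nat) d) (H x y).

Definition zero_1jet (H : R -> R -> R) : Prop :=
  H 0 0 = 0 /\ Derive (fun x => H x 0) 0 = 0 /\ Derive (fun y => H 0 y) 0 = 0.

(** A planar system x' = P(x,y), y' = Q(x,y) is given by the pair P, Q. *)
Definition isolated_singular_origin (P Q : R -> R -> R) : Prop :=
  P 0 0 = 0 /\ Q 0 0 = 0 /\
  locally_2d (fun x y => P x y = 0 -> Q x y = 0 -> x = 0 /\ y = 0) 0 0.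

(** g(x) = c x^k + O(x^(k+1)) as x -> 0. *)
Definition leading_term (g : R -> R) (c : R) (k : nat) : Prop :=
  exists K : R, locally 0 (fun x => Rabs (g x - c * x ^ k) <= K * Rabs x ^ S k).

(** The derivatives at the endpoints are two-sided; this is no restriction,
    since a solution on the closed interval extends differentiably. *)
Definition reaches (P Q : R -> R -> R) (t : R) (p q : R * R) : Prop :=
  exists x y : R -> R,
    (forall s, Rmin 0 t <= s <= Rmax 0 t ->
       is_derive x s (P (x s) (y s)) /\ is_derive y s (Q (x s) (y s))) /\
    (x 0, y 0) = p /\ (x t, y t) = q.

(** Arbitrary at a pair (t, p) for which the solution through p does not
    exist up to time t. Near a singular point at which P and Q are locally
    Lipschitz this does not occur for t = 1, and the endpoint is unique. *)
Definition flow (P Q : R -> R -> R) (t : R) (p : R * R) : R * R :=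
  epsilon (inhabits (0, 0)) (reaches P Q t p).

Definition unit_time_map (P Q : R -> R -> R) : R * R -> R * R := flow P Q 1.

Definition characteristic_map (P Q : R -> R -> R) (f : R -> R) (x : R) : R :=
  fst (unit_time_map P Q (x, f x)).

Definition Xfield (A : R -> R -> R) (x y : R) : R := y + A x y.
Definition Yfield (B : R -> R -> R) (x y : R) : R := B x y.

(** By the implicit function theorem f is unique as a germ at 0, and
    analytic there. *)
Definition characteristic_curve (A : R -> R -> R) (f : R -> R) : Prop :=
  f 0 = 0 /\ continuous f 0 /\ locally 0 (fun x => f x + A x (f x) = 0).

Definition Fcurve (B : R -> R -> R) (f : R -> R) (x : R) : R := B x (f x).

Definition Gcurve (A B : R -> R -> R) (f : R -> R) (x : R) : R :=
  Derive (fun s => A s (f x)) x + Derive (fun y => B x y) (f x).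

Definition phi (A : R -> R -> R) (f : R -> R) (k : nat) (x : R) : R :=
  / INR (fact k) * Derive_n (fun y => Xfield A x y) k (f x).

Definition psi (A B : R -> R -> R) (f : R -> R) (k : nat) (x : R) : R :=
  / INR (fact k) * (Derive_n (fun y => Yfield B x y) k (f x)
                    - Derive f x * Derive_n (fun y => Xfield A x y) k (f x)).

(** The system straightened by u = x, v = y - f(x). *)
Definition Ufield (A : R -> R -> R) (f : R -> R) (u v : R) : R :=
  Series (fun k => phi A f (S k) u * v ^ S k).

Definition Vfield (A B : R -> R -> R) (f : R -> R) (u v : R) : R :=
  Series (fun k => psi A B f k u * v ^ k).

(* Main.v *)
Require Import Defs.
From Stdlib Require Import Reals Factorial Lra Lia Classical ClassicalEpsilon.
From Stdlib Require Import FunctionalExtensionality PropExtensionality.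
From Coquelicot Require Import Coquelicot.
Open Scope R_scope.

(** The substitution u = x, v = y - f(x) conjugates the two flows and leaves
    the first coordinate alone, and it sends the starting point (x, f(x)) to
    (x, 0); so both time-one maps have the same first coordinate. Three facts
    must be supplied to make this argument work near the origin.

    First, the right-hand sides of the straightened system, which are series
    in v, must sum to the transformed vector field
    (X, Y - f' X)(u, f(u) + v) on a square whose size does not depend on u.
    By [analytic2_slice_series] each slice y |-> H(x, y) is a power series with
    coefficient bounds uniform in x, and by [taylor_series_of_power_series] a
    power series can be recentred with a radius that depends on those bounds
    only. Both are the same rearrangement of a double series, from diagonals
    to columns ([is_series_columns_of_diagonals]), justified by geometric
    bounds on the terms. The outcome is [straightened_fields].

    Second, f must be differentiable near 0, so that the substitution may be
    differentiated along solutions. As A has zero 1-jet, it is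
    1/2-Lipschitz near the origin, which makes f = - A(x, f) 1-Lipschitz; the
    expansion of A at (x, f(x)) then gives f'
    ([characteristic_curve_regular]).

    Third, the curves that witness a time-one map could leave the region where
    these facts hold. The fields grow at most linearly there, so a Gronwall
    estimate, run up to a barrier that it shows is never reached, confines
    every solution that starts near the origin ([gronwall_barrier],
    [solution_trapped]). The same estimate gives uniqueness of the endpoint
    ([solution_unique]).

    If a solution reaches time one, conjugacy and uniqueness identify the two
    endpoints. If none does, the conjugacy rules it out for both systems, and
    both flows are the choice of a point from the same empty set
    ([fst_flow_eq]). *)

(** * Rearranging double series *)


Lemma series_geometric_bound (a : nat -> R) (C q : R) :
  0 <= q < 1 -> (forall n, Rabs (a n) <= C * q ^ n) ->
  ex_series a /\ Rabs (Series a) <= C / (1 - q).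
Proof.
intros hq ha.
assert (hg : is_series (fun n => C * q ^ n) (C / (1 - q))).
{ apply (is_series_scal_l (K := R_AbsRing) (V := R_NormedModule) C).
  apply is_series_geom. rewrite Rabs_pos_eq; lra. }
assert (hexg : ex_series (fun n => C * q ^ n)) by (eexists; exact hg).
assert (hex : ex_series (fun n => Rabs (a n))).
{ apply (ex_series_le (K := R_AbsRing) (V := R_CompleteNormedModule)
           _ (fun n => C * q ^ n)); [|exact hexg].
  intros n. unfold norm; simpl; unfold abs; simpl. rewrite Rabs_Rabsolu; auto. }
split; [now apply ex_series_Rabs|].
eapply Rle_trans; [now apply Series_Rabs|].
rewrite <- (is_series_unique _ _ hg).
apply Series_le; [|exact hexg].
intros n; split; [apply Rabs_pos|auto].
Qed.

Lemma Rabs_sum_n_le (a b : nat -> R) (n : nat) :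
  (forall k, (k <= n)%nat -> Rabs (a k) <= b k) ->
  Rabs (sum_n a n) <= sum_n b n.
Proof.
induction n as [|n IH]; intros h.
- rewrite !sum_O. apply h; lia.
- rewrite !sum_Sn. unfold plus; simpl.
  eapply Rle_trans; [apply Rabs_triang|].
  apply Rplus_le_compat; [apply IH; intros; apply h; lia|apply h; lia].
Qed.

Lemma sum_n_rev (a : nat -> R) (n : nat) :
  sum_n (fun i => a (n - i)%nat) n = sum_n a n.
Proof.
revert a; induction n as [|n IH]; intros a.
- now rewrite !sum_O.
- rewrite sum_Sn, Nat.sub_diag.
  rewrite (sum_n_ext_loc _ (fun i => a (S (n - i)))).
  2: intros k hk; f_equal; lia.
  rewrite (IH (fun i => a (S i))).
  unfold sum_n at 2. rewrite (sum_Sn_m _ 0 (S n)) by lia.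
  rewrite <- sum_n_m_S. apply plus_comm.
Qed.

Lemma sum_n_diagonals (t : nat -> nat -> R) (N : nat) :
  sum_n (fun d => sum_n (fun i => t i (d - i)%nat) d) N
  = sum_n (fun j => sum_n (fun i => t i j) (N - j)) N.
Proof.
induction N as [|N IH].
- rewrite !sum_O. simpl. now rewrite ?sum_O.
- rewrite sum_Sn, IH.
  rewrite (sum_Sn (fun j => sum_n (fun i => t i j) (S N - j))), Nat.sub_diag, sum_O.
  rewrite (sum_n_ext_loc (fun j => sum_n (fun i => t i j) (S N - j))
    (fun j => plus (sum_n (fun i => t i j) (N - j)) (t (S N - j)%nat j))).
  2:{ intros j hj. replace (S N - j)%nat with (S (N - j)) by lia.
      now rewrite sum_Sn. }
  rewrite sum_n_plus, <- plus_assoc. f_equal.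
  rewrite <- (sum_n_rev (fun i => t i (S N - i)%nat)), sum_Sn, Nat.sub_diag.
  f_equal.
  apply sum_n_ext_loc. intros j hj. f_equal. lia.
Qed.

Lemma sum_n_Rminus (a b : nat -> R) (n : nat) :
  sum_n (fun k => a k - b k) n = sum_n a n - sum_n b n.
Proof.
induction n as [|n IH]; [now rewrite !sum_O|].
rewrite !sum_Sn, IH. unfold plus; simpl. ring.
Qed.

(** The series of n q^(n-1) is the derivative of the geometric series, so it
    has the same radius of convergence and its terms tend to 0. *)
Lemma is_lim_seq_nat_geometric (q : R) :
  0 <= q < 1 -> is_lim_seq (fun n => INR (S n) * q ^ n) 0.
Proof.
intros hq.
(* Any point strictly between q and 1 bounds the radius from below. *)
set (q' := (q + 1) / 2).
assert (hb : is_lub_Rbar _ _) by exact (CV_radius_bounded (fun _ => 1)).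
assert (hr : Rbar_lt (Rabs q) (CV_radius (PS_derive (fun _ => 1)))).
{ rewrite CV_radius_derive.
  apply Rbar_lt_le_trans with (Finite q').
  - simpl. rewrite Rabs_pos_eq; unfold q'; lra.
  - apply hb. exists 1. intros n.
    rewrite Rmult_1_l, <- RPow_abs.
    rewrite <- (pow1 n). apply pow_incr. split; [apply Rabs_pos|].
    rewrite Rabs_pos_eq; unfold q'; lra. }
apply CV_disk_inside in hr.
apply ex_series_Rabs, ex_series_lim_0 in hr.
eapply is_lim_seq_ext; [|exact hr].
intros n. unfold PS_derive. ring.
Qed.

(** The first N diagonals are the first N columns with column j cut at height
    N - j. Each of the N + 1 cut-off tails is O(q^N), so the partial sums by
    columns and by diagonals differ by O(N q^N). *)
Lemma is_series_columns_of_diagonals (t : nat -> nat -> R) (M q l : R) :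
  0 <= q < 1 ->
  (forall i j, Rabs (t i j) <= M * q ^ (i + j)) ->
  is_series (fun d => sum_n (fun i => t i (d - i)%nat) d) l ->
  is_series (fun j => Series (fun i => t i j)) l.
Proof.
intros hq ht hl.
assert (hcol : forall j, ex_series (fun i => t i j)).
{ intros j. apply (series_geometric_bound _ (M * q ^ j) q hq).
  intros i. eapply Rle_trans; [apply ht|]. rewrite pow_add. right; ring. }
assert (htail : forall N, Rabs (sum_n (fun j => Series (fun i => t i j)) N
   - sum_n (fun d => sum_n (fun i => t i (d - i)%nat) d) N)
   <= M * q / (1 - q) * (INR (S N) * q ^ N)).
{ intros N. rewrite sum_n_diagonals.
  apply Rle_trans with (sum_n (fun _ => M * q ^ (S N) / (1 - q)) N).
  2:{ rewrite sum_n_const. right. simpl pow. field. lra. }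
  replace (_ - _) with (sum_n (fun j => Series (fun i => t i j)
             - sum_n (fun i => t i j) (N - j)) N).
  2: apply sum_n_Rminus.
  apply Rabs_sum_n_le. intros j hj.
  rewrite (Series_incr_n (fun i => t i j) (S (N - j))) by (lia || auto).
  rewrite sum_n_Reals. simpl Init.Nat.pred.
  match goal with |- Rabs (?a + ?b - ?a) <= _ =>
    replace (a + b - a) with b by ring end.
  apply series_geometric_bound; [exact hq|].
  intros n. eapply Rle_trans; [apply ht|].
  replace (S (N - j) + n + j)%nat with (S N + n)%nat by lia.
  rewrite pow_add. right; ring. }
unfold is_series in *.
change (is_lim_seq (sum_n (fun j => Series (fun i => t i j))) l).
change (is_lim_seq (sum_n (fun d => sum_n (fun i => t i (d - i)%nat) d)) l) in hl.
assert (hd : is_lim_seq (fun N => sum_n (fun j => Series (fun i => t i j)) N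
   - sum_n (fun d => sum_n (fun i => t i (d - i)%nat) d) N) 0).
{ apply is_lim_seq_abs_0.
  apply (is_lim_seq_le_le (fun _ => 0) _
           (fun N => M * q / (1 - q) * (INR (S N) * q ^ N))).
  - intros N; split; [apply Rabs_pos|apply htail].
  - apply is_lim_seq_const.
  - replace (Finite 0) with (Rbar_mult (M * q / (1 - q)) 0)
      by (simpl; f_equal; ring).
    apply is_lim_seq_scal_l, is_lim_seq_nat_geometric, hq. }
replace l with (0 + l) by ring.
eapply is_lim_seq_ext; [|exact (is_lim_seq_plus' _ _ _ _ hd hl)].
intros N; simpl; ring.
Qed.

Lemma two_pow_ge (n : nat) : INR n + 1 <= 2 ^ n.
Proof.
induction n as [|n IH]; [simpl; lra|].
rewrite S_INR. simpl. pose proof (pos_INR n). lra.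
Qed.

Lemma binomial_coefficient_le (i k : nat) : 0 <= Binomial.C (i + k) i <= 2 ^ (i + k).
Proof.
assert (hpos : forall n m, 0 <= Binomial.C n m).
{ intros n m. unfold Binomial.C, Rdiv.
  apply Rmult_le_pos; [apply pos_INR|].
  left; apply Rinv_0_lt_compat, Rmult_lt_0_compat; apply INR_fact_lt_0. }
split; [auto|].
replace 2 with (1 + 1) by ring.
rewrite binomial.
rewrite (sum_eq _ (fun m => Binomial.C (i + k) m)).
2: intros; rewrite !pow1; ring.
rewrite <- sum_n_Reals.
assert (forall N, (i <= N)%nat ->
  Binomial.C (i + k) i <= sum_n (fun m => Binomial.C (i + k) m) N) as h.
2: apply h; lia.
assert (hs : forall N, 0 <= sum_n (fun m => Binomial.C (i + k) m) N).
{ intros N. eapply Rle_trans; [apply Rabs_pos|].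
  apply Rabs_sum_n_le. intros. rewrite Rabs_pos_eq; [apply Rle_refl|auto]. }
intros N hN. induction hN as [|m hm IH].
- destruct i; [rewrite sum_O; lra|].
  rewrite sum_Sn. specialize (hs i).
  change (Binomial.C (S i + k) (S i)
    <= sum_n (fun m => Binomial.C (S i + k) m) i + Binomial.C (S i + k) (S i)).
  lra.
- rewrite sum_Sn. specialize (hpos (i + k)%nat (S m)).
  eapply Rle_trans; [exact IH|].
  rewrite <- (Rplus_0_r (sum_n _ m)) at 1. now apply Rplus_le_compat_l.
Qed.


(** * First-order estimates for analytic functions of two variables *)

(** Cauchy estimates: at the corner (s, s) with s half the given
    radius, the terms of the absolutely convergent series are bounded. *)
Lemma analytic2_cauchy_bound (H : R -> R -> R) (x0 y0 : R) :
  analytic2_at H x0 y0 ->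
  exists (c : nat -> nat -> R) (s M : R), 0 < s /\ 0 <= M /\
    (forall i j, Rabs (c i j) * s ^ (i + j) <= M) /\
    (forall h k, Rabs h <= s -> Rabs k <= s ->
      is_series (fun d => sum_n (fun i => c i (d - i)%nat * h ^ i * k ^ (d - i)) d)
        (H (x0 + h) (y0 + k))).
Proof.
intros [c [r hc]].
pose proof (cond_pos r) as hr.
set (s := r / 2).
assert (hs : 0 < s < r) by (unfold s; lra).
assert (hsr : Rabs s < r) by (rewrite Rabs_pos_eq; lra).
assert (hbound : exists M, forall d,
  sum_n (fun i => Rabs (c i (d - i)%nat * s ^ i * s ^ (d - i))) d <= M).
{ destruct (hc (x0 + s) (y0 + s)) as [hex _].
  1,2: match goal with |- Rabs ?e < _ => replace e with s by ring end; exact hsr.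
  apply ex_series_lim_0 in hex.
  destruct (filterlim_bounded (K := R_AbsRing) (V := R_NormedModule) _
    (ex_intro (fun l : R => filterlim _ eventually (locally l)) 0 hex)) as [M hM]. exists M. intros d.
  eapply Rle_trans; [|apply (hM d)].
  eapply Rle_trans; [|apply Rle_abs].
  right. apply sum_n_ext. intros i. f_equal. f_equal; [f_equal|]; f_equal; ring. }
destruct hbound as [M hM].
assert (hterm : forall i j, Rabs (c i j) * s ^ (i + j) <= M).
{ intros i j. eapply Rle_trans; [|apply (hM (i + j)%nat)].
  assert (hle : forall (a : nat -> R) N k, (k <= N)%nat ->
    Rabs (a k) <= sum_n (fun i => Rabs (a i)) N).
  { intros a N. induction N as [|N IH]; intros k hk.
    - rewrite sum_O. replace k with 0%nat by lia. apply Rle_refl.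
    - rewrite sum_Sn. change (plus (G := R_AbelianMonoid)) with Rplus.
      assert (hp : 0 <= sum_n (fun i => Rabs (a i)) N).
      { eapply Rle_trans; [apply Rabs_pos|]. apply (IH 0%nat). lia. }
      pose proof (Rabs_pos (a (S N))).
      destruct (Nat.eq_dec k (S N)) as [->|]; [lra|].
      specialize (IH k). assert (k <= N)%nat by lia. intuition lra. }
  eapply Rle_trans; [|apply (hle (fun i0 => c i0 (i + j - i0)%nat * s ^ i0
    * s ^ (i + j - i0)) _ i); lia].
  replace (i + j - i)%nat with j by lia.
  rewrite !Rabs_mult, pow_add, !(Rabs_pos_eq (s ^ _)) by (apply pow_le; lra).
  right; ring. }
exists c, s, M. split; [lra|]. split; [|split; [exact hterm|]].
- eapply Rle_trans; [|apply (hterm 0%nat 0%nat)]. simpl.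
  rewrite Rmult_1_r. apply Rabs_pos.
- intros h k hh hk.
  destruct (hc (x0 + h) (y0 + k)) as [_ hl].
  1: replace (x0 + h - x0) with h by ring; lra.
  1: replace (y0 + k - y0) with k by ring; lra.
  eapply is_series_ext; [|exact hl].
  intros d. apply sum_n_ext. intros i. f_equal; [f_equal|]; f_equal; ring.
Qed.

(** The factor rho on the left avoids the exponent n - 1, and with it a case
    split at n = 0. *)
Lemma pow_difference_bound (x x' rho : R) (n : nat) :
  Rabs x <= rho -> Rabs x' <= rho ->
  rho * Rabs (x ^ n - x' ^ n) <= INR n * rho ^ n * Rabs (x - x').
Proof.
intros hx hx'.
assert (h0 : 0 <= rho) by (pose proof (Rabs_pos x); lra).
induction n as [|n IH].
- simpl. replace (1 - 1) with 0 by ring. rewrite Rabs_R0. lra.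
- replace (x ^ S n - x' ^ S n) with (x * (x ^ n - x' ^ n) + x' ^ n * (x - x'))
    by (simpl; ring).
  assert (h1 : Rabs (x' ^ n) <= rho ^ n).
  { rewrite <- RPow_abs. apply pow_incr. split; [apply Rabs_pos|exact hx']. }
  eapply Rle_trans.
  { apply Rmult_le_compat_l; [exact h0|]. apply Rabs_triang. }
  rewrite !Rabs_mult, S_INR. simpl pow.
  assert (h2 := Rabs_pos (x ^ n - x' ^ n)). assert (h3 := Rabs_pos (x - x')).
  assert (h4 : Rabs (x' ^ n) * Rabs (x - x') <= rho ^ n * Rabs (x - x'))
    by (now apply Rmult_le_compat_r).
  assert (h5 : Rabs x * Rabs (x ^ n - x' ^ n) <= rho * Rabs (x ^ n - x' ^ n))
    by (now apply Rmult_le_compat_r).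
  nra.
Qed.

Lemma monomial_difference_bound (x y x' y' rho : R) (i j : nat) :
  Rabs x <= rho -> Rabs y <= rho -> Rabs x' <= rho -> Rabs y' <= rho ->
  rho * Rabs (x ^ i * y ^ j - x' ^ i * y' ^ j)
  <= INR (i + j) * rho ^ (i + j) * (Rabs (x - x') + Rabs (y - y')).
Proof.
intros hx hy hx' hy'.
assert (h0 : 0 <= rho) by (pose proof (Rabs_pos x); lra).
replace (x ^ i * y ^ j - x' ^ i * y' ^ j)
  with ((x ^ i - x' ^ i) * y ^ j + x' ^ i * (y ^ j - y' ^ j)) by ring.
eapply Rle_trans.
{ apply Rmult_le_compat_l; [exact h0|]. apply Rabs_triang. }
rewrite !Rabs_mult, plus_INR, pow_add.
assert (hp : forall z n, Rabs z <= rho -> Rabs (z ^ n) <= rho ^ n).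
{ intros z n hz. rewrite <- RPow_abs. apply pow_incr. split; [apply Rabs_pos|exact hz]. }
pose proof (pow_difference_bound x x' rho i hx hx') as h1.
pose proof (pow_difference_bound y y' rho j hy hy') as h2.
assert (h3 : rho * Rabs (x ^ i - x' ^ i) * Rabs (y ^ j)
  <= INR i * rho ^ i * Rabs (x - x') * rho ^ j).
{ apply Rmult_le_compat; auto using Rabs_pos. apply Rmult_le_pos; auto using Rabs_pos. }
assert (h4 : rho * Rabs (y ^ j - y' ^ j) * Rabs (x' ^ i)
  <= INR j * rho ^ j * Rabs (y - y') * rho ^ i).
{ apply Rmult_le_compat; auto using Rabs_pos. apply Rmult_le_pos; auto using Rabs_pos. }
assert (h5 : 0 <= INR i * (rho ^ i * rho ^ j) * Rabs (y - y')).
{ repeat apply Rmult_le_pos; auto using Rabs_pos, pos_INR, pow_le. }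
assert (h6 : 0 <= INR j * (rho ^ i * rho ^ j) * Rabs (x - x')).
{ repeat apply Rmult_le_pos; auto using Rabs_pos, pos_INR, pow_le. }
lra.
Qed.

(** Subtracting two copies of the series termwise, the terms of degree 0 cancel
    and those of degree 1 form the differential. A term of degree d >= 2
    contributes O(d^2 (rho/s)^d / rho) times the distance of the two points,
    and the sum of these factors is O(rho). Taking one point to be the centre
    gives differentiability there; taking both free gives Lipschitz bounds. *)
Lemma analytic2_strict_diff (H : R -> R -> R) (x0 y0 : R) :
  analytic2_at H x0 y0 ->
  exists l1 l2 K delta, 0 < delta /\ 0 <= K /\
    forall rho h k h' k', 0 < rho <= delta ->
      Rabs h <= rho -> Rabs k <= rho -> Rabs h' <= rho -> Rabs k' <= rho ->
      Rabs (H (x0 + h) (y0 + k) - H (x0 + h') (y0 + k')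
            - (l1 * (h - h') + l2 * (k - k')))
      <= K * rho * (Rabs (h - h') + Rabs (k - k')).
Proof.
intros hH.
destruct (analytic2_cauchy_bound H x0 y0 hH) as (c & s & M & hs & hM & hc & hl).
exists (c 1%nat 0%nat), (c 0%nat 1%nat), (32 * M / s ^ 2), (s / 8).
split; [lra|]. split.
{ apply Rmult_le_pos; [lra|]. left; apply Rinv_0_lt_compat, pow_lt, hs. }
intros rho h k h' k' hrho hh hk hh' hk'.
set (D := Rabs (h - h') + Rabs (k - k')).
assert (hD : 0 <= D) by (unfold D; pose proof (Rabs_pos (h - h'));
  pose proof (Rabs_pos (k - k')); lra).
set (theta := rho / s).
assert (hth : 0 <= theta <= 1 / 8).
{ unfold theta. split.
  - apply Rmult_le_pos; [lra|]. left; now apply Rinv_0_lt_compat.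
  - apply Rmult_le_reg_r with s; [exact hs|]. unfold Rdiv.
    rewrite Rmult_assoc, Rinv_l; lra. }
assert (hrt : rho = theta * s) by (unfold theta; field; lra).
set (a := fun d => sum_n (fun i => c i (d - i)%nat * h ^ i * k ^ (d - i)) d
                 - sum_n (fun i => c i (d - i)%nat * h' ^ i * k' ^ (d - i)) d).
assert (ha : is_series a (H (x0 + h) (y0 + k) - H (x0 + h') (y0 + k'))).
{ apply (is_series_minus (K := R_AbsRing) (V := R_NormedModule));
  apply hl; lra. }
assert (habs : forall d, rho * Rabs (a d) <= M * D * (4 * theta) ^ d).
{ intros d. unfold a. rewrite <- sum_n_Rminus.
  rewrite <- (Rabs_pos_eq rho) at 1 by lra. rewrite <- Rabs_mult.
  rewrite <- (sum_n_mult_l (K := R_Ring) rho).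
  eapply Rle_trans.
  { apply Rabs_sum_n_le with (b := fun _ => M * (INR d * theta ^ d * D)).
    intros i hi.
    change (mult (K := R_Ring)) with Rmult.
    replace (rho * _) with (c i (d - i)%nat *
      (rho * (h ^ i * k ^ (d - i) - h' ^ i * k' ^ (d - i)))) by ring.
    rewrite 2!Rabs_mult, (Rabs_pos_eq rho) by lra.
    eapply Rle_trans.
    { apply Rmult_le_compat_l; [apply Rabs_pos|].
      apply monomial_difference_bound; eassumption. }
    fold D. replace (i + (d - i))%nat with d by lia.
    rewrite hrt, Rpow_mult_distr.
    replace (_ * _) with ((Rabs (c i (d - i)%nat) * s ^ d) * (INR d * theta ^ d * D))
      by ring.
    apply Rmult_le_compat_r.
    - repeat apply Rmult_le_pos; auto using pos_INR. apply pow_le; lra.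
    - replace d with (i + (d - i))%nat at 2 by lia. apply hc. }
  rewrite sum_n_const, Rpow_mult_distr, S_INR.
  (* Both factors d + 1 (number of terms) and d (from the monomials) are at
     most 2^d, hence the ratio 4 theta. *)
  replace 4 with (2 * 2) by ring. rewrite (Rpow_mult_distr 2 2).
  pose proof (two_pow_ge d) as h2. pose proof (pos_INR d) as hd.
  assert (hnn : 0 <= M * D * theta ^ d)
    by (repeat apply Rmult_le_pos; auto; apply pow_le; lra).
  replace ((INR d + 1) * (M * (INR d * theta ^ d * D)))
    with (M * D * theta ^ d * ((INR d + 1) * INR d)) by ring.
  replace (M * D * (2 ^ d * 2 ^ d * theta ^ d))
    with (M * D * theta ^ d * (2 ^ d * 2 ^ d)) by ring.
  apply Rmult_le_compat_l; [exact hnn|].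
  apply Rmult_le_compat; lra. }
assert (hlow : a 0%nat + a 1%nat = c 1%nat 0%nat * (h - h') + c 0%nat 1%nat * (k - k')).
{ unfold a. rewrite !sum_Sn, !sum_O. unfold plus; simpl. ring. }
assert (hser : Series (fun n => a (2 + n)%nat)
  = H (x0 + h) (y0 + k) - H (x0 + h') (y0 + k')
    - (c 1%nat 0%nat * (h - h') + c 0%nat 1%nat * (k - k'))).
{ assert (hex : ex_series a) by (eexists; exact ha).
  pose proof (Series_incr_n a 2 ltac:(lia) hex) as he.
  rewrite (is_series_unique _ _ ha) in he. simpl sum_f_R0 in he.
  rewrite he, <- hlow. ring. }
rewrite <- hser.
destruct (series_geometric_bound (fun n => a (2 + n)%nat)
  (M * D * (4 * theta) ^ 2 / rho) (4 * theta)) as [_ hfin]; [lra| |].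
{ intros n. apply Rmult_le_reg_l with rho; [lra|].
  eapply Rle_trans; [apply habs|]. rewrite pow_add. right. field. lra. }
eapply Rle_trans; [exact hfin|].
replace (32 * M / s ^ 2 * rho * D) with (M * D * (4 * theta) ^ 2 / rho * 2).
2:{ unfold theta. field. lra. }
apply Rmult_le_compat_l.
- apply Rmult_le_pos; [|left; apply Rinv_0_lt_compat; lra].
  apply Rmult_le_pos; [now apply Rmult_le_pos|apply pow_le; lra].
- replace 2 with (/ (/ 2)) by field. apply Rinv_le_contravar; lra.
Qed.


Lemma is_derive_quadratic_remainder (g : R -> R) (x l K delta : R) :
  0 < delta ->
  (forall h, Rabs h <= delta -> Rabs (g (x + h) - g x - l * h) <= K * Rabs h ^ 2) ->
  is_derive g x l.
Proof.
intros hd hg. apply is_derive_Reals. intros eps heps.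
assert (hK : 0 < Rabs K + 1) by (pose proof (Rabs_pos K); lra).
assert (hpos : 0 < Rmin delta (eps / (Rabs K + 1))).
{ apply Rmin_glb_lt; [exact hd|]. now apply Rdiv_lt_0_compat. }
exists (mkposreal _ hpos). intros h h0 hh. simpl in hh.
assert (h1 : Rabs h < delta) by (eapply Rlt_le_trans; [exact hh|apply Rmin_l]).
assert (h2 : Rabs h < eps / (Rabs K + 1))
  by (eapply Rlt_le_trans; [exact hh|apply Rmin_r]).
assert (hp : 0 < Rabs h) by now apply Rabs_pos_lt.
replace ((g (x + h) - g x) / h - l) with ((g (x + h) - g x - l * h) / h)
  by (field; exact h0).
unfold Rdiv. rewrite Rabs_mult, Rabs_inv.
apply Rmult_lt_reg_r with (Rabs h); [exact hp|].
rewrite Rmult_assoc, Rinv_l, Rmult_1_r by lra.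
eapply Rle_lt_trans; [apply hg; lra|].
apply Rmult_lt_compat_r with (r := Rabs K + 1) in h2; [|exact hK].
unfold Rdiv in h2. rewrite Rmult_assoc, Rinv_l, Rmult_1_r in h2 by lra.
pose proof (Rle_abs K). simpl. nra.
Qed.

(** With both first partials zero, [analytic2_strict_diff] bounds the
    Lipschitz constant on a square by a multiple of its size. *)
Lemma zero_1jet_lipschitz (H : R -> R -> R) (eps : R) :
  analytic2_at H 0 0 -> zero_1jet H -> 0 < eps ->
  exists delta, 0 < delta /\ forall x y x' y',
    Rabs x <= delta -> Rabs y <= delta -> Rabs x' <= delta -> Rabs y' <= delta ->
    Rabs (H x y - H x' y') <= eps * (Rabs (x - x') + Rabs (y - y')).
Proof.
intros hH [_ [hx hy]] heps.
destruct (analytic2_strict_diff H 0 0 hH) as (l1 & l2 & K & d & hd & hK & hs).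
assert (e1 : l1 = 0).
{ rewrite <- hx. symmetry. apply is_derive_unique.
  apply (is_derive_quadratic_remainder _ 0 l1 K d hd). intros h hh.
  destruct (Req_dec h 0) as [->|hn].
  - rewrite Rplus_0_r, Rabs_R0. replace (_ - _) with 0 by ring.
    rewrite Rabs_R0. simpl. lra.
  - assert (0 < Rabs h) by now apply Rabs_pos_lt.
    specialize (hs (Rabs h) h 0 0 0). rewrite Rabs_R0, !Rplus_0_r, !Rminus_0_r, Rabs_R0 in hs.
    rewrite Rmult_0_r, !Rplus_0_r in hs. rewrite !Rplus_0_l in *.
    eapply Rle_trans; [apply hs; lra|]. right; ring. }
assert (e2 : l2 = 0).
{ rewrite <- hy. symmetry. apply is_derive_unique.
  apply (is_derive_quadratic_remainder _ 0 l2 K d hd). intros h hh.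
  destruct (Req_dec h 0) as [->|hn].
  - rewrite Rplus_0_r, Rabs_R0. replace (_ - _) with 0 by ring.
    rewrite Rabs_R0. simpl. lra.
  - assert (0 < Rabs h) by now apply Rabs_pos_lt.
    specialize (hs (Rabs h) 0 h 0 0). rewrite Rabs_R0, !Rplus_0_r, !Rminus_0_r, Rabs_R0 in hs.
    rewrite Rmult_0_r, !Rplus_0_l in hs. rewrite !Rplus_0_l in *.
    eapply Rle_trans; [apply hs; lra|]. right; ring. }
subst l1 l2.
exists (Rmin d (eps / (K + 1))).
assert (hq : 0 < eps / (K + 1)) by (apply Rdiv_lt_0_compat; lra).
assert (hpos : 0 < Rmin d (eps / (K + 1))) by now apply Rmin_glb_lt.
split; [exact hpos|].
intros x y x' y' h1 h2 h3 h4.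
specialize (hs (Rmin d (eps / (K + 1))) x y x' y').
rewrite !Rplus_0_l, !Rmult_0_l, Rplus_0_l, Rminus_0_r in hs.
eapply Rle_trans; [apply hs; auto; split; [exact hpos|apply Rmin_l]|].
apply Rmult_le_compat_r.
- pose proof (Rabs_pos (x - x')); pose proof (Rabs_pos (y - y')); lra.
- apply Rle_trans with (K * (eps / (K + 1))).
  + apply Rmult_le_compat_l; [exact hK|apply Rmin_r].
  + apply Rmult_le_reg_r with (K + 1); [lra|].
    replace (K * (eps / (K + 1)) * (K + 1)) with (K * eps) by (field; lra). nra.
Qed.

Lemma locally_0_Rabs (P : R -> Prop) :
  locally 0 P <-> exists d, 0 < d /\ forall x, Rabs x < d -> P x.
Proof.
split.
- intros [d hd]. exists d. split; [apply cond_pos|]. intros x hx. apply hd.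
  change (Rabs (x - 0) < d). now rewrite Rminus_0_r.
- intros [d [h0 hd]]. exists (mkposreal d h0). intros x hx. apply hd.
  change (Rabs (x - 0) < d) in hx. now rewrite Rminus_0_r in hx.
Qed.

(** * Regularity of the characteristic curve *)

(** Implicit differentiation. Subtracting f = - A(x, f) at two points and using
    that A is 1/2-Lipschitz absorbs half of the difference of f, so f is
    1-Lipschitz. The first-order expansion of A at (x, f(x)) then reads
    (1 + l2) (f(x+h) - f(x)) + l1 h = O(h^2), where l1 and l2 are the partials
    of A; the Lipschitz bound on A keeps 1 + l2 away from 0. *)
Lemma characteristic_curve_regular (A : R -> R -> R) (f : R -> R) :
  locally_2d (analytic2_at A) 0 0 -> zero_1jet A -> characteristic_curve A f ->
  exists delta, 0 < delta /\
    (forall x, Rabs x < delta -> f x + A x (f x) = 0) /\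
    (forall x x', Rabs x < delta -> Rabs x' < delta ->
       Rabs (f x - f x') <= Rabs (x - x')) /\
    (forall x, Rabs x < delta -> ex_derive f x).
Proof.
intros [d1 hA] hA1 (hf0 & hfc & hfe).
assert (hA0 : analytic2_at A 0 0).
{ apply hA; rewrite Rminus_0_r, Rabs_R0; apply cond_pos. }
destruct (zero_1jet_lipschitz A (1 / 2) hA0 hA1) as (d2 & hd2 & hlip); [lra|].
apply locally_0_Rabs in hfe. destruct hfe as (d3 & hd3 & hfe).
pose proof (cond_pos d1) as hd1.
assert (hd12 : 0 < Rmin d1 d2) by now apply Rmin_glb_lt.
assert (hsmall : locally 0 (fun x => Rabs (f x) < Rmin d1 d2)).
{ assert (hb := hfc _ (locally_ball (f 0) (mkposreal _ hd12))).
  apply locally_0_Rabs in hb. apply locally_0_Rabs.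
  destruct hb as (d & hd & hb). exists d. split; [exact hd|]. intros x hx.
  specialize (hb x hx). rewrite hf0 in hb.
  change (Rabs (f x - 0) < Rmin d1 d2) in hb. now rewrite Rminus_0_r in hb. }
apply locally_0_Rabs in hsmall. destruct hsmall as (d4 & hd4 & hsmall).
set (delta := Rmin (Rmin d1 d2) (Rmin d3 d4)).
assert (hdelta : 0 < delta) by (repeat apply Rmin_glb_lt; auto).
assert (hle : delta <= d1 /\ delta <= d2 /\ delta <= d3 /\ delta <= d4).
{ unfold delta. pose proof (Rmin_l (Rmin d1 d2) (Rmin d3 d4)).
  pose proof (Rmin_r (Rmin d1 d2) (Rmin d3 d4)).
  pose proof (Rmin_l d1 d2); pose proof (Rmin_r d1 d2).
  pose proof (Rmin_l d3 d4); pose proof (Rmin_r d3 d4). lra. }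
pose proof (Rmin_l d1 d2) as hm1. pose proof (Rmin_r d1 d2) as hm2.
assert (hfs : forall x, Rabs x < delta -> Rabs (f x) < d1 /\ Rabs (f x) < d2).
{ intros x hx. specialize (hsmall x ltac:(lra)). lra. }
assert (hfl : forall x x', Rabs x < delta -> Rabs x' < delta ->
  Rabs (f x - f x') <= Rabs (x - x')).
{ intros x x' hx hx'.
  pose proof (hfe x ltac:(lra)) as e. pose proof (hfe x' ltac:(lra)) as e'.
  assert (hn : f x - f x' = - (A x (f x) - A x' (f x'))) by lra.
  pose proof (hfs x hx). pose proof (hfs x' hx').
  specialize (hlip x (f x) x' (f x') ltac:(lra) ltac:(lra) ltac:(lra) ltac:(lra)).
  rewrite <- (Rabs_Ropp (A x (f x) - _)), <- hn in hlip. lra. }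
exists delta. split; [exact hdelta|].
split; [intros x hx; apply hfe; lra|]. split; [exact hfl|].
intros x hx.
destruct (hfs x hx) as [hx1 hx2].
destruct (analytic2_strict_diff A x (f x)) as (l1 & l2 & K & d & hd & hK & hs).
{ apply hA; rewrite Rminus_0_r; lra. }
assert (hl2 : 1 + l2 <> 0).
(* If 1 + l2 were 0, then A would change by - t + O(t^2) over a vertical step
   t, against the bound t / 2; t is small enough to see the contradiction. *)
{ intros h0.
  set (t := Rmin (Rmin d (d2 - Rabs (f x))) (1 / (4 * (K + 1)))).
  assert (hKi : 0 < 1 / (4 * (K + 1))) by (apply Rdiv_lt_0_compat; lra).
  assert (ht : 0 < t) by (repeat apply Rmin_glb_lt; auto; lra).
  assert (ht2 : t <= d /\ t <= d2 - Rabs (f x) /\ t <= 1 / (4 * (K + 1))).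
  { unfold t. pose proof (Rmin_l (Rmin d (d2 - Rabs (f x))) (1 / (4 * (K + 1)))).
    pose proof (Rmin_r (Rmin d (d2 - Rabs (f x))) (1 / (4 * (K + 1)))).
    pose proof (Rmin_l d (d2 - Rabs (f x))). pose proof (Rmin_r d (d2 - Rabs (f x))). lra. }
  assert (hta : Rabs t = t) by (apply Rabs_pos_eq; lra).
  specialize (hs t 0 t 0 0 ltac:(lra)).
  rewrite Rabs_R0, hta, !Rplus_0_r, !Rminus_0_r, Rabs_R0, hta, Rmult_0_r, !Rplus_0_l in hs.
  specialize (hs ltac:(lra) ltac:(lra) ltac:(lra) ltac:(lra)).
  assert (hft : Rabs (f x + t) <= d2)
    by (pose proof (Rabs_triang (f x) t); lra).
  specialize (hlip x (f x + t) x (f x) ltac:(lra) hft ltac:(lra) ltac:(lra)).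
  replace (x - x) with 0 in hlip by ring. replace (f x + t - f x) with t in hlip by ring.
  rewrite Rabs_R0, hta in hlip.
  replace (l2 * t) with (- t) in hs by (replace l2 with (-1) by lra; ring).
  apply Rabs_le_between in hs. apply Rabs_le_between in hlip.
  assert (K * t <= 1 / 4).
  { apply Rle_trans with ((K + 1) * (1 / (4 * (K + 1)))).
    - nra.
    - right. field. lra. }
  nra. }
exists (- l1 / (1 + l2)).
apply (is_derive_quadratic_remainder f x _ (2 * K / Rabs (1 + l2))
  (Rmin d ((delta - Rabs x) / 2))).
{ apply Rmin_glb_lt; lra. }
intros h hh.
assert (hh1 : Rabs h <= d) by (eapply Rle_trans; [exact hh|apply Rmin_l]).
assert (hh2 : Rabs h <= (delta - Rabs x) / 2) by (eapply Rle_trans; [exact hh|apply Rmin_r]).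
assert (hxh : Rabs (x + h) < delta) by (pose proof (Rabs_triang x h); lra).
assert (hp : 0 < Rabs (1 + l2)) by now apply Rabs_pos_lt.
pose proof (hfl (x + h) x hxh hx) as hlf.
replace (x + h - x) with h in hlf by ring.
pose proof (hfe x ltac:(lra)) as e. pose proof (hfe (x + h) ltac:(lra)) as e'.
assert (hrem : Rabs ((1 + l2) * (f (x + h) - f x) + l1 * h) <= 2 * K * Rabs h ^ 2).
{ destruct (Req_dec h 0) as [->|hn].
  { rewrite Rplus_0_r. replace (_ + _) with 0 by ring. rewrite Rabs_R0. simpl. lra. }
  assert (0 < Rabs h) by now apply Rabs_pos_lt.
  specialize (hs (Rabs h) h (f (x + h) - f x) 0 0 ltac:(lra) ltac:(lra) hlf).
  rewrite Rabs_R0 in hs. specialize (hs ltac:(lra) ltac:(lra)).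
  rewrite !Rplus_0_r, !Rminus_0_r in hs.
  replace (f x + (f (x + h) - f x)) with (f (x + h)) in hs by ring.
  rewrite <- Rabs_Ropp.
  replace (- ((1 + l2) * (f (x + h) - f x) + l1 * h))
    with (A (x + h) (f (x + h)) - A x (f x) - (l1 * h + l2 * (f (x + h) - f x))) by lra.
  eapply Rle_trans; [exact hs|].
  replace (2 * K * Rabs h ^ 2) with (K * Rabs h * (Rabs h + Rabs h)) by ring.
  apply Rmult_le_compat_l; [apply Rmult_le_pos; lra|lra]. }
replace (f (x + h) - f x - - l1 / (1 + l2) * h)
  with (((1 + l2) * (f (x + h) - f x) + l1 * h) / (1 + l2)) by (field; exact hl2).
unfold Rdiv. rewrite Rabs_mult, Rabs_inv.
replace (2 * K * / Rabs (1 + l2) * Rabs h ^ 2) with (2 * K * Rabs h ^ 2 * / Rabs (1 + l2)) by ring.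
apply Rmult_le_compat_r; [left; now apply Rinv_0_lt_compat|exact hrem].
Qed.

(** * Taylor series in y with a uniform radius *)

(** The coefficients are sums over the powers of x, and the Cauchy
    estimates bound them uniformly for |x| <= s / 2; this is what makes the
    Taylor radius in [analytic2_taylor_in_y] independent of x. *)
Lemma analytic2_slice_series (H : R -> R -> R) :
  analytic2_at H 0 0 ->
  exists s M, 0 < s /\ forall x, Rabs x <= s / 2 ->
    exists b : nat -> R, (forall j, Rabs (b j) * s ^ j <= M) /\
      forall y, Rabs y <= s / 2 -> is_series (fun j => b j * y ^ j) (H x y).
Proof.
intros hH.
destruct (analytic2_cauchy_bound H 0 0 hH) as (c & s & M & hs & hM & hc & hl).
exists s, (M / (1 - 1 / 2)). split; [exact hs|]. intros x hx.
assert (hp : forall z n, Rabs z <= s / 2 -> Rabs (z ^ n) <= s ^ n * (1 / 2) ^ n).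
{ intros z n hz. rewrite <- RPow_abs, <- Rpow_mult_distr. apply pow_incr.
  split; [apply Rabs_pos|lra]. }
exists (fun j => Series (fun i => c i j * x ^ i)). split.
- intros j. rewrite <- (Rabs_pos_eq (s ^ j)) by (apply pow_le; lra).
  rewrite <- Rabs_mult, <- Series_scal_r.
  apply series_geometric_bound; [lra|]. intros i.
  rewrite !Rabs_mult, (Rabs_pos_eq (s ^ j)) by (apply pow_le; lra).
  apply Rle_trans with (Rabs (c i j) * (s ^ i * (1 / 2) ^ i) * s ^ j).
  + apply Rmult_le_compat_r; [apply pow_le; lra|].
    apply Rmult_le_compat_l; [apply Rabs_pos|auto].
  + replace (_ * s ^ j) with (Rabs (c i j) * s ^ (i + j) * (1 / 2) ^ i)
      by (rewrite pow_add; ring).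
    apply Rmult_le_compat_r; [apply pow_le; lra|apply hc].
- intros y hy.
  specialize (hl x y ltac:(lra) ltac:(lra)). rewrite !Rplus_0_l in hl.
  eapply is_series_ext.
  { intros j. apply Series_scal_r. }
  apply (is_series_columns_of_diagonals (fun i j => c i j * x ^ i * y ^ j) M (1 / 2));
    [lra| |exact hl].
  intros i j. rewrite !Rabs_mult.
  apply Rle_trans with (Rabs (c i j) * (s ^ i * (1 / 2) ^ i) * (s ^ j * (1 / 2) ^ j)).
  + apply Rmult_le_compat; auto using Rabs_pos.
    * apply Rmult_le_pos; apply Rabs_pos.
    * apply Rmult_le_compat_l; [apply Rabs_pos|auto].
  + replace (_ * _) with (Rabs (c i j) * s ^ (i + j) * (1 / 2) ^ (i + j))
      by (rewrite !pow_add; ring).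
    apply Rmult_le_compat_r; [apply pow_le; lra|apply hc].
Qed.

(** Expanding b_d (y0 + w)^d by the binomial theorem turns the series of g
    into a sum by diagonals, whose columns are the powers of w. Since
    C(i+k, i) <= 2^(i+k), the terms are geometrically small with ratio 1/4 for
    |y0|, |w| <= s / 8. The column sums are the Taylor coefficients by
    uniqueness of power series. *)
Lemma taylor_series_of_power_series (g : R -> R) (b : nat -> R) (s N y0 v : R) :
  0 < s -> (forall j, Rabs (b j) * s ^ j <= N) ->
  (forall y, Rabs y <= s / 2 -> is_series (fun j => b j * y ^ j) (g y)) ->
  Rabs y0 <= s / 8 -> Rabs v <= s / 8 ->
  is_series (fun k => / INR (fact k) * Derive_n g k y0 * v ^ k) (g (y0 + v)).
Proof.
intros hs hb hg hy hv.
set (a := fun k => Series (fun i => Binomial.C (i + k) i * b (i + k)%nat * y0 ^ i)).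
assert (ha : forall w, Rabs w <= s / 8 ->
  is_series (fun k => a k * w ^ k) (g (y0 + w))).
{ intros w hw.
  assert (hyw : Rabs (y0 + w) <= s / 2) by (pose proof (Rabs_triang y0 w); lra).
  eapply is_series_ext.
  { intros k. apply Series_scal_r. }
  apply (is_series_columns_of_diagonals
    (fun i k => Binomial.C (i + k) i * b (i + k)%nat * y0 ^ i * w ^ k) N (1 / 4)); [lra| |].
  - intros i k. rewrite !Rabs_mult.
    pose proof (binomial_coefficient_le i k) as hC.
    rewrite (Rabs_pos_eq (Binomial.C _ _)) by lra.
    assert (hp : forall z n, Rabs z <= s / 8 -> Rabs (z ^ n) <= (s / 8) ^ n).
    { intros z n hz. rewrite <- RPow_abs. apply pow_incr. split; [apply Rabs_pos|exact hz]. }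
    apply Rle_trans with
      (2 ^ (i + k) * Rabs (b (i + k)%nat) * (s / 8) ^ i * (s / 8) ^ k).
    + generalize dependent (Binomial.C (i + k) i). intros bc hC.
      repeat apply Rmult_le_compat; repeat apply Rmult_le_pos; auto using Rabs_pos; lra.
    + apply Rle_trans with (Rabs (b (i + k)%nat) * s ^ (i + k) * (1 / 4) ^ (i + k)).
      * right.
        replace (2 ^ (i + k) * Rabs (b (i + k)%nat) * (s / 8) ^ i * (s / 8) ^ k)
          with (Rabs (b (i + k)%nat) * (2 ^ (i + k) * ((s / 8) ^ i * (s / 8) ^ k))) by ring.
        rewrite <- pow_add, Rmult_assoc, <- !Rpow_mult_distr. do 2 f_equal. field.
      * apply Rmult_le_compat_r; [apply pow_le; lra|apply hb].
  - eapply is_series_ext; [|apply hg; exact hyw].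
    intros d. simpl. rewrite binomial, <- sum_n_Reals.
    rewrite <- (sum_n_mult_l (K := R_Ring) (b d)).
    apply sum_n_ext_loc. intros i hi.
    replace (i + (d - i))%nat with d by lia.
    change (mult (K := R_Ring)) with Rmult. 
    match goal with |- ?l = ?r => change (@eq R l r) end. ring. }
assert (hrad : Rbar_lt 0 (CV_radius a)).
{ apply Rbar_lt_le_trans with (Finite (s / 8)); [simpl; lra|].
  apply (CV_radius_bounded a).
  assert (hs8 : Rabs (s / 8) <= s / 8) by (rewrite Rabs_pos_eq; lra).
  assert (hex := ex_series_lim_0 _ (ex_intro _ _ (ha (s / 8) hs8))).
  destruct (filterlim_bounded (K := R_AbsRing) (V := R_NormedModule) _
    (ex_intro (fun l : R => filterlim _ eventually (locally l)) 0 hex)) as [M hM].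
  exists M. exact hM. }
assert (hda : forall k, Derive_n g k y0 = a k * INR (fact k)).
{ intros k. rewrite <- (Derive_n_coef a k hrad).
  rewrite <- (Rplus_0_l y0) at 1. rewrite <- Derive_n_comp_trans.
  apply Derive_n_ext_loc. apply locally_0_Rabs.
  exists (s / 8). split; [lra|]. intros w hw. rewrite Rplus_comm.
  symmetry. apply is_series_unique, ha. lra. }
eapply is_series_ext; [|apply ha, hv].
intros k. simpl. rewrite hda. field. apply INR_fact_neq_0.
Qed.

Lemma is_series_linear (y : R) :
  is_series (fun j => (if Nat.eqb j 1 then 1 else 0) * y ^ j) y.
Proof.
change (is_lim_seq (sum_n (fun j => (if Nat.eqb j 1 then 1 else 0) * y ^ j)) y).
apply (is_lim_seq_ext_loc (fun _ => y)); [|apply is_lim_seq_const].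
exists 1%nat. intros n hn. induction hn as [|n hn IH].
- rewrite sum_Sn, sum_O. unfold plus; simpl. ring.
- rewrite sum_Sn, <- IH. unfold plus; simpl.
  destruct n; [lia|]. simpl. ring.
Qed.

(** The term e y makes one statement serve both components of the system:
    e = 1 for y + A and e = 0 for B. *)
Lemma analytic2_taylor_in_y (e : R) (H : R -> R -> R) :
  analytic2_at H 0 0 ->
  exists delta, 0 < delta /\ forall x y0 v,
    Rabs x <= delta -> Rabs y0 <= delta -> Rabs v <= delta ->
    is_series (fun k => / INR (fact k) * Derive_n (fun y => e * y + H x y) k y0 * v ^ k)
      (e * (y0 + v) + H x (y0 + v)).
Proof.
intros hH. destruct (analytic2_slice_series H hH) as (s & M & hs & hsl).
exists (s / 8). split; [lra|]. intros x y0 v hx hy hv.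
destruct (hsl x ltac:(lra)) as (b & hb & hser).
apply (taylor_series_of_power_series (fun y => e * y + H x y)
  (fun j => e * (if Nat.eqb j 1 then 1 else 0) + b j) s (Rabs e * s + M)); auto.
- intros j. eapply Rle_trans.
  { apply Rmult_le_compat_r; [apply pow_le; lra|apply Rabs_triang]. }
  rewrite Rmult_plus_distr_r. apply Rplus_le_compat; [|apply hb].
  rewrite Rabs_mult, Rmult_assoc. apply Rmult_le_compat_l; [apply Rabs_pos|].
  destruct (Nat.eqb_spec j 1) as [->|_].
  + rewrite Rabs_R1. lra.
  + rewrite Rabs_R0. lra.
- intros y hy'. eapply is_series_ext.
  2: apply (is_series_plus (K := R_AbsRing) (V := R_NormedModule));
     [apply (is_series_scal_l (K := R_AbsRing) (V := R_NormedModule) e), (is_series_linear y)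
     |apply hser, hy'].
  intros j. unfold plus, scal; simpl. unfold mult; simpl. ring.
Qed.


(** The series of the first component starts at k = 1; its missing term is
    X(u, f(u)), which vanishes on the characteristic curve. *)
Lemma straightened_fields (A B : R -> R -> R) (f : R -> R) :
  analytic2_at A 0 0 -> analytic2_at B 0 0 ->
  exists delta, 0 < delta /\ forall u v,
    Rabs u <= delta -> Rabs (f u) <= delta -> Rabs v <= delta ->
    Xfield A u (f u) = 0 ->
    Ufield A f u v = Xfield A u (f u + v) /\
    Vfield A B f u v = Yfield B u (f u + v) - Derive f u * Xfield A u (f u + v).
Proof.
intros hA hB.
destruct (analytic2_taylor_in_y 1 A hA) as (d1 & hd1 & tA).
destruct (analytic2_taylor_in_y 0 B hB) as (d2 & hd2 & tB).
pose proof (Rmin_l d1 d2) as hm1. pose proof (Rmin_r d1 d2) as hm2.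
exists (Rmin d1 d2). split; [now apply Rmin_glb_lt|].
intros u v hu hfu hv h0.
specialize (tA u (f u) v ltac:(lra) ltac:(lra) ltac:(lra)).
specialize (tB u (f u) v ltac:(lra) ltac:(lra) ltac:(lra)).
assert (sX : is_series (fun k => / INR (fact k) *
    Derive_n (fun y => Xfield A u y) k (f u) * v ^ k) (Xfield A u (f u + v))).
{ unfold Xfield at 2. rewrite Rmult_1_l in tA.
  eapply is_series_ext; [|exact tA]. intros k. simpl. do 2 f_equal.
  apply Derive_n_ext. intros t. unfold Xfield. ring. }
assert (sY : is_series (fun k => / INR (fact k) *
    Derive_n (fun y => Yfield B u y) k (f u) * v ^ k) (Yfield B u (f u + v))).
{ unfold Yfield at 2. rewrite Rmult_0_l, Rplus_0_l in tB.
  eapply is_series_ext; [|exact tB]. intros k. simpl. do 2 f_equal.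
  apply Derive_n_ext. intros t. unfold Yfield. ring. }
split.
- pose proof (Series_incr_1 _ (ex_intro _ _ sX)) as e.
  rewrite (is_series_unique _ _ sX) in e. rewrite e.
  change (Derive_n (fun y => Xfield A u y) 0 (f u)) with (Xfield A u (f u)).
  rewrite h0, Rmult_0_r, Rmult_0_l, Rplus_0_l. reflexivity.
- unfold Vfield. apply is_series_unique.
  eapply is_series_ext.
  2: apply (is_series_minus (K := R_AbsRing) (V := R_NormedModule)); [exact sY|];
     apply (is_series_scal_l (K := R_AbsRing) (V := R_NormedModule) (Derive f u)), sX.
  intros k. unfold psi, plus, opp, scal; simpl. unfold mult; simpl. ring.
Qed.

(** * Confinement and uniqueness of solutions *)

Lemma lipschitz_derivative_bound (f : R -> R) (x l k delta : R) :
  0 < delta -> is_derive f x l ->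
  (forall h, Rabs h < delta -> Rabs (f (x + h) - f x) <= k * Rabs h) ->
  Rabs l <= k.
Proof.
intros hd hl hk. apply le_epsilon. intros eps heps.
apply is_derive_Reals in hl. destruct (hl eps heps) as [e he].
pose proof (cond_pos e) as he0.
set (h := Rmin e delta / 2).
pose proof (Rmin_l e delta). pose proof (Rmin_r e delta).
assert (hmin : 0 < Rmin e delta) by now apply Rmin_glb_lt.
assert (hh : 0 < h) by (unfold h; lra).
assert (hha : Rabs h = h) by (apply Rabs_pos_eq; lra).
specialize (he h ltac:(lra) ltac:(rewrite hha; unfold h; lra)).
specialize (hk h ltac:(rewrite hha; unfold h; lra)). rewrite hha in hk.
assert (hq : Rabs ((f (x + h) - f x) / h) <= k).
{ unfold Rdiv. rewrite Rabs_mult, Rabs_inv, hha.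
  apply Rmult_le_reg_r with h; [exact hh|]. rewrite Rmult_assoc, Rinv_l by lra. lra. }
pose proof (Rabs_triang ((f (x + h) - f x) / h) (- ((f (x + h) - f x) / h - l))) as ht.
rewrite Rabs_Ropp in ht.
replace ((f (x + h) - f x) / h + - ((f (x + h) - f x) / h - l)) with l in ht by ring.
lra.
Qed.

(** The differential inequality is only assumed below the level d. While w
    stays below d, the function w exp(-K s) does not increase, so w is at most
    w(0) exp(K), which is strictly below d; by continuity w cannot then be on
    the verge of crossing d. *)
Lemma gronwall_barrier (w dw : R -> R) (K d : R) :
  0 <= K -> 0 <= w 0 -> w 0 * exp K < d ->
  (forall s, 0 <= s <= 1 -> is_derive w s (dw s)) ->
  (forall s, 0 <= s <= 1 -> w s < d -> dw s <= K * w s) ->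
  forall s, 0 <= s <= 1 -> w s <= w 0 * exp K.
Proof.
intros hK hw0 hd hw hdw.
assert (hloc : forall t, 0 <= t <= 1 -> (forall s, 0 <= s < t -> w s < d) ->
  w t <= w 0 * exp K).
{ intros t ht hlt.
  assert (hder : forall s, 0 <= s <= 1 -> is_derive (fun s => w s * exp (- K * s)) s
    ((dw s - K * w s) * exp (- K * s))).
  { intros s hs. specialize (hw s hs).
    assert (he : is_derive (fun s => exp (- K * s)) s (- K * exp (- K * s))).
    { auto_derive; [auto|ring]. }
    replace ((dw s - K * w s) * exp (- K * s))
      with (dw s * exp (- K * s) + w s * (- K * exp (- K * s))) by ring.
    apply (is_derive_mult (K := R_AbsRing) w (fun s => exp (- K * s))); auto.
    intros; apply Rmult_comm. }
  (* The derivative bound holds on the open interval only, where w < d is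
     known, while the mean value theorem may return an endpoint. Replacing
     the derivative by its minimum with 0 leaves it unchanged inside. *)
  destruct (MVT_gen (fun s => w s * exp (- K * s)) 0 t
    (fun s => Rmin 0 ((dw s - K * w s) * exp (- K * s)))) as (c & hc & he).
  - rewrite Rmin_left, Rmax_right by lra. intros s hs.
    rewrite Rmin_right; [apply hder; lra|].
    specialize (hdw s ltac:(lra) (hlt s ltac:(lra))).
    pose proof (exp_pos (- K * s)). nra.
  - rewrite Rmin_left, Rmax_right by lra. intros s hs.
    apply continuity_pt_filterlim.
    apply (ex_derive_continuous (K := R_AbsRing) (V := R_NormedModule)
      (fun s => w s * exp (- K * s)) s).
    eexists; apply hder; lra.
  - simpl in he. rewrite Rmult_0_r, exp_0, Rmult_1_r, Rminus_0_r in he.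
    pose proof (Rmin_l 0 ((dw c - K * w c) * exp (- K * c))) as hm.
    assert (hle : w t * exp (- K * t) <= w 0) by nra.
    assert (h1 : w t = w t * exp (- K * t) * exp (K * t)).
    { rewrite Rmult_assoc, <- exp_plus. replace (- K * t + K * t) with 0 by ring.
      rewrite exp_0; ring. }
    rewrite h1. apply Rle_trans with (w 0 * exp (K * t)).
    + apply Rmult_le_compat_r; [left; apply exp_pos|exact hle].
    + apply Rmult_le_compat_l; [exact hw0|].
      destruct (Rle_lt_or_eq_dec (K * t) K) as [hlt'|heq]; [nra| |].
      * left; now apply exp_increasing.
      * rewrite heq; lra. }
(* Continuous induction: T is the last time before which w stays below d. *)
set (E := fun t => 0 <= t <= 1 /\ forall s, 0 <= s < t -> w s < d).
destruct (completeness E) as [T [hub hlub]].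
{ exists 1. intros t [ht _]; lra. }
{ exists 0. split; [lra|]. intros; lra. }
assert (hT0 : 0 <= T) by (apply hub; split; [lra|intros; lra]).
assert (hT1 : T <= 1) by (apply hlub; intros t [ht _]; lra).
assert (hET : forall s, 0 <= s < T -> w s < d).
{ intros s hs. apply NNPP. intros hn.
  assert (T <= s); [|lra]. apply hlub. intros t [ht hlt].
  apply Rnot_lt_le. intros hst. apply hn, hlt. lra. }
assert (hT : T = 1).
{ apply NNPP. intros hne.
  assert (hwT : w T < d) by (pose proof (hloc T ltac:(lra) hET); lra).
  assert (hcont : continuous w T).
  { apply (ex_derive_continuous (K := R_AbsRing) (V := R_NormedModule)).
    eexists; apply hw; lra. }
  assert (hp : 0 < d - w T) by lra.
  destruct (hcont _ (locally_ball (w T) (mkposreal _ hp))) as [e he].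
  pose proof (cond_pos e) as he0.
  set (t := Rmin 1 (T + e)).
  assert (ht : T < t) by (unfold t; apply Rmin_glb_lt; lra).
  assert (ht1 : t <= 1) by apply Rmin_l.
  assert (ht2 : t <= T + e) by apply Rmin_r.
  assert (T >= t); [|lra]. apply Rle_ge, hub. split; [lra|]. intros s hs.
  destruct (Rlt_le_dec s T) as [hsT|hsT]; [apply hET; lra|].
  assert (hb : Rabs (w s - w T) < d - w T).
  { apply (he s). change (Rabs (s - T) < e). apply Rabs_def1; lra. }
  apply Rabs_def2 in hb. lra. }
subst T. intros s hs. apply hloc; [exact hs|]. intros s' hs'. apply hET. lra.
Qed.

Definition solves (P Q : R -> R -> R) (x y : R -> R) : Prop :=
  forall s, 0 <= s <= 1 ->
    is_derive x s (P (x s) (y s)) /\ is_derive y s (Q (x s) (y s)).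

Lemma reaches_one_iff (P Q : R -> R -> R) (p q : R * R) :
  reaches P Q 1 p q <->
  exists x y, solves P Q x y /\ (x 0, y 0) = p /\ (x 1, y 1) = q.
Proof.
unfold reaches, solves.
rewrite Rmin_left, Rmax_right by lra. reflexivity.
Qed.

(** Gronwall for w = x^2 + y^2, with the barrier at r^2. *)
Lemma solution_trapped (P Q : R -> R -> R) (L r : R) :
  0 <= L -> 0 < r ->
  (forall x y, Rabs x < r -> Rabs y < r ->
     Rabs (P x y) <= L * (Rabs x + Rabs y) /\ Rabs (Q x y) <= L * (Rabs x + Rabs y)) ->
  exists eta, 0 < eta /\ forall x y, solves P Q x y ->
    Rabs (x 0) < eta -> Rabs (y 0) < eta ->
    forall s, 0 <= s <= 1 -> Rabs (x s) < r /\ Rabs (y s) < r.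
Proof.
intros hL hr hPQ.
set (E := exp (4 * L)).
assert (hE : 1 <= E).
{ unfold E. pose proof (exp_ineq1_le (4 * L)). lra. }
exists (r / (2 * E)). split; [apply Rdiv_lt_0_compat; lra|].
intros x y hs hx0 hy0.
assert (hsq : forall z, z ^ 2 = Rabs z ^ 2) by (intros; now rewrite pow2_abs).
assert (hlt : forall u v, u ^ 2 + v ^ 2 < r ^ 2 -> Rabs u < r /\ Rabs v < r).
{ intros u v huv. split; apply Rabs_lt_between; split; nra. }
assert (hw0 : (x 0 ^ 2 + y 0 ^ 2) * E < r ^ 2).
{ set (eta := r / (2 * E)) in *.
  assert (hrE : r = eta * (2 * E)) by (unfold eta; field; lra).
  rewrite (hsq (x 0)), (hsq (y 0)).
  pose proof (Rabs_pos (x 0)); pose proof (Rabs_pos (y 0)).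
  assert (Rabs (x 0) ^ 2 + Rabs (y 0) ^ 2 <= 2 * eta ^ 2) by nra.
  assert (0 < eta ^ 2) by (apply pow_lt; lra).
  apply Rle_lt_trans with (2 * eta ^ 2 * E).
  - apply Rmult_le_compat_r; lra.
  - rewrite hrE. replace ((eta * (2 * E)) ^ 2) with (4 * eta ^ 2 * E * E) by ring.
    assert (0 < eta ^ 2 * E) by (apply Rmult_lt_0_compat; lra). nra. }
intros s hs1. apply hlt. eapply Rle_lt_trans; [|exact hw0].
apply (gronwall_barrier (fun s => x s ^ 2 + y s ^ 2)
  (fun s => 2 * x s * P (x s) (y s) + 2 * y s * Q (x s) (y s)) (4 * L) (r ^ 2));
  try exact hs1; try exact hw0; try lra.
- pose proof (pow2_ge_0 (x 0)); pose proof (pow2_ge_0 (y 0)); lra.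
- intros t ht. destruct (hs t ht) as [hx hy].
  auto_derive.
  + split; [eexists; exact hx|split; [eexists; exact hy|auto]].
  + rewrite (is_derive_unique (fun z : R => x z) _ _ hx), (is_derive_unique (fun z : R => y z) _ _ hy). ring.
- intros t ht hwt. destruct (hlt _ _ hwt) as [hxr hyr].
  destruct (hPQ _ _ hxr hyr) as [hP hQ].
  rewrite (hsq (x t)), (hsq (y t)).
  assert (h1 : x t * P (x t) (y t) <= Rabs (x t) * (L * (Rabs (x t) + Rabs (y t)))).
  { eapply Rle_trans; [apply Rle_abs|]. rewrite Rabs_mult.
    apply Rmult_le_compat_l; [apply Rabs_pos|exact hP]. }
  assert (h2 : y t * Q (x t) (y t) <= Rabs (y t) * (L * (Rabs (x t) + Rabs (y t)))).
  { eapply Rle_trans; [apply Rle_abs|]. rewrite Rabs_mult.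
    apply Rmult_le_compat_l; [apply Rabs_pos|exact hQ]. }
  assert (h3 : 0 <= L * (Rabs (x t) - Rabs (y t)) ^ 2)
    by (apply Rmult_le_pos; [lra|apply pow2_ge_0]).
  nra.
Qed.

(** Gronwall for the squared distance of the two solutions, which is 0 at
    time 0; the level 1 of the barrier is arbitrary. *)
Lemma solution_unique (P Q : R -> R -> R) (L r : R) (x y x' y' : R -> R) :
  0 <= L ->
  (forall u v u' v', Rabs u < r -> Rabs v < r -> Rabs u' < r -> Rabs v' < r ->
     Rabs (P u v - P u' v') <= L * (Rabs (u - u') + Rabs (v - v')) /\
     Rabs (Q u v - Q u' v') <= L * (Rabs (u - u') + Rabs (v - v'))) ->
  solves P Q x y -> solves P Q x' y' ->
  (forall s, 0 <= s <= 1 -> Rabs (x s) < r /\ Rabs (y s) < r) ->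
  (forall s, 0 <= s <= 1 -> Rabs (x' s) < r /\ Rabs (y' s) < r) ->
  x 0 = x' 0 -> y 0 = y' 0 ->
  x 1 = x' 1 /\ y 1 = y' 1.
Proof.
intros hL hlip hs hs' ht ht' hx0 hy0.
assert (hw : (x 1 - x' 1) ^ 2 + (y 1 - y' 1) ^ 2
  <= ((x 0 - x' 0) ^ 2 + (y 0 - y' 0) ^ 2) * exp (4 * L)).
{ apply (gronwall_barrier (fun s => (x s - x' s) ^ 2 + (y s - y' s) ^ 2)
    (fun s => 2 * (x s - x' s) * (P (x s) (y s) - P (x' s) (y' s))
            + 2 * (y s - y' s) * (Q (x s) (y s) - Q (x' s) (y' s))) (4 * L) 1);
    try lra.
  - rewrite hx0, hy0. simpl. lra.
  - rewrite hx0, hy0. simpl. lra.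
  - intros t h. destruct (hs t h) as [hx hy]. destruct (hs' t h) as [hx' hy'].
    auto_derive.
    + repeat split; eexists; eassumption.
    + rewrite (is_derive_unique (fun z : R => x z) _ _ hx), (is_derive_unique (fun z : R => y z) _ _ hy),
        (is_derive_unique (fun z : R => x' z) _ _ hx'), (is_derive_unique (fun z : R => y' z) _ _ hy'). ring.
  - intros t h _. destruct (ht t h), (ht' t h).
    destruct (hlip (x t) (y t) (x' t) (y' t)) as [hP hQ]; auto.
    set (u := x t - x' t) in *. set (v := y t - y' t) in *.
    rewrite <- (pow2_abs u), <- (pow2_abs v).
    assert (h1 : u * (P (x t) (y t) - P (x' t) (y' t))
      <= Rabs u * (L * (Rabs u + Rabs v))).
    { eapply Rle_trans; [apply Rle_abs|]. rewrite Rabs_mult.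
      apply Rmult_le_compat_l; [apply Rabs_pos|exact hP]. }
    assert (h2 : v * (Q (x t) (y t) - Q (x' t) (y' t))
      <= Rabs v * (L * (Rabs u + Rabs v))).
    { eapply Rle_trans; [apply Rle_abs|]. rewrite Rabs_mult.
      apply Rmult_le_compat_l; [apply Rabs_pos|exact hQ]. }
    assert (h3 : 0 <= L * (Rabs u - Rabs v) ^ 2)
      by (apply Rmult_le_pos; [lra|apply pow2_ge_0]).
    nra. }
rewrite hx0, hy0 in hw.
replace (((x' 0 - x' 0) ^ 2 + (y' 0 - y' 0) ^ 2) * exp (4 * L)) with 0 in hw by ring.
pose proof (pow2_ge_0 (x 1 - x' 1)). pose proof (pow2_ge_0 (y 1 - y' 1)).
split; apply Rminus_diag_uniq, Rsqr_0_uniq; rewrite Rsqr_pow2; lra.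
Qed.

(** * Conjugacy of the two systems *)

(** Chain rule: the derivative of y - f(x) along a solution is
    Q - f'(x) P. *)
Lemma solves_straighten (P Q U V : R -> R -> R) (f : R -> R) (r : R) (x y : R -> R) :
  (forall u v, Rabs u < r -> Rabs v < r ->
     ex_derive f u /\ U u v = P u (f u + v) /\
     V u v = Q u (f u + v) - Derive f u * P u (f u + v)) ->
  (forall s, 0 <= s <= 1 -> Rabs (x s) < r /\ Rabs (y s - f (x s)) < r) ->
  solves P Q x y -> solves U V x (fun s => y s - f (x s)).
Proof.
intros hUV hr hs s h. destruct (hs s h) as [hx hy]. destruct (hr s h) as [h1 h2].
destruct (hUV _ _ h1 h2) as (hf & eU & eV).
rewrite eU, eV. replace (f (x s) + (y s - f (x s))) with (y s) by ring.
split; [exact hx|].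
apply (is_derive_minus (K := R_AbsRing) (V := R_NormedModule)); [exact hy|].
rewrite Rmult_comm.
apply (is_derive_comp (K := R_AbsRing) (V := R_NormedModule)); [|exact hx].
now apply Derive_correct.
Qed.

Lemma solves_unstraighten (P Q U V : R -> R -> R) (f : R -> R) (r : R) (u v : R -> R) :
  (forall u v, Rabs u < r -> Rabs v < r ->
     ex_derive f u /\ U u v = P u (f u + v) /\
     V u v = Q u (f u + v) - Derive f u * P u (f u + v)) ->
  (forall s, 0 <= s <= 1 -> Rabs (u s) < r /\ Rabs (v s) < r) ->
  solves U V u v -> solves P Q u (fun s => f (u s) + v s).
Proof.
intros hUV hr hs s h. destruct (hs s h) as [hu hv]. destruct (hr s h) as [h1 h2].
destruct (hUV _ _ h1 h2) as (hf & eU & eV).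
rewrite eU in hu. rewrite eV in hv. split; [exact hu|].
replace (Q (u s) (f (u s) + v s)) with
  (P (u s) (f (u s) + v s) * Derive f (u s) +
   (Q (u s) (f (u s) + v s) - Derive f (u s) * P (u s) (f (u s) + v s))) by ring.
apply (is_derive_plus (K := R_AbsRing) (V := R_NormedModule)); [|exact hv].
apply (is_derive_comp (K := R_AbsRing) (V := R_NormedModule)); [|exact hu].
now apply Derive_correct.
Qed.

(** When neither system reaches time t, the two sets of endpoints are both
    empty, hence equal, and so are the points chosen from them. *)
Lemma fst_flow_eq (P Q U V : R -> R -> R) (t : R) (p p' : R * R) :
  (forall q, reaches P Q t p q -> exists q', reaches U V t p' q') ->
  (forall q', reaches U V t p' q' -> exists q, reaches P Q t p q /\ fst q = fst q') ->
  (forall q1 q2, reaches P Q t p q1 -> reaches P Q t p q2 -> q1 = q2) ->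
  fst (flow P Q t p) = fst (flow U V t p').
Proof.
intros h1 h2 hu. unfold flow.
destruct (classic (exists q, reaches P Q t p q)) as [he|hn].
- assert (he' : exists q', reaches U V t p' q') by (destruct he as [q hq]; eauto).
  assert (hq := epsilon_spec (inhabits (0, 0)) _ he).
  assert (hq' := epsilon_spec (inhabits (0, 0)) _ he').
  destruct (h2 _ hq') as (q & hr & <-). f_equal. now apply hu.
- do 2 f_equal. apply functional_extensionality. intros q.
  apply propositional_extensionality. split; intros h; exfalso; apply hn.
  + eauto.
  + destruct (h2 q h) as (q0 & hq0 & _). eauto.
Qed.

Theorem proposition5 (A B : R -> R -> R) (f : R -> R)
    (a b : R) (m n : nat)
    (hA : locally_2d (analytic2_at A) 0 0)
    (hB : locally_2d (analytic2_at B) 0 0)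
    (hA1 : zero_1jet A)
    (hB1 : zero_1jet B)
    (hiso : isolated_singular_origin (Xfield A) (Yfield B))
    (hf : characteristic_curve A f)
    (hm : (1 <= m)%nat)
    (ha : a <> 0)
    (hF : leading_term (Fcurve B f) a m)
    (hG : leading_term (Gcurve A B f) b n) :
  locally 0 (fun x =>
    characteristic_map (Xfield A) (Yfield B) f x
    = characteristic_map (Ufield A f) (Vfield A B f) (fun _ => 0) x).
Proof.
assert (hA0 : analytic2_at A 0 0) by (now apply locally_2d_singleton in hA).
assert (hB0 : analytic2_at B 0 0) by (now apply locally_2d_singleton in hB).
destruct (zero_1jet_lipschitz A (1 / 2) hA0 hA1) as (d1 & hd1 & lipA); [lra|].
destruct (zero_1jet_lipschitz B (1 / 2) hB0 hB1) as (d2 & hd2 & lipB); [lra|].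
destruct (characteristic_curve_regular A f hA hA1 hf) as (d3 & hd3 & fX & flip & fder).
destruct (straightened_fields A B f hA0 hB0) as (d4 & hd4 & fields).
destruct hA1 as [A00 _]. destruct hB1 as [B00 _]. destruct hf as [f0 _].
(* Solutions of the original system are confined to radius r / 2, so that
   |y - f(x)| <= |x| + |y| < r; conversely |f(u) + v| < 2 r when |u|, |v| < r,
   which is why the Lipschitz bounds are needed on radius 2 r. *)
assert (hr : exists r, 0 < r /\ 2 * r <= d1 /\ 2 * r <= d2 /\ r <= d3 /\ r <= d4).
{ exists (Rmin (Rmin d1 d2) (Rmin d3 d4) / 2).
  pose proof (Rmin_l (Rmin d1 d2) (Rmin d3 d4)).
  pose proof (Rmin_r (Rmin d1 d2) (Rmin d3 d4)).
  pose proof (Rmin_l d1 d2); pose proof (Rmin_r d1 d2).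
  pose proof (Rmin_l d3 d4); pose proof (Rmin_r d3 d4).
  assert (0 < Rmin (Rmin d1 d2) (Rmin d3 d4)) by (repeat apply Rmin_glb_lt; auto).
  lra. }
destruct hr as (r & hr & hr1 & hr2 & hr3 & hr4).
assert (flin : forall x, Rabs x < r -> Rabs (f x) <= Rabs x).
{ intros x hx. specialize (flip x 0 ltac:(lra) ltac:(rewrite Rabs_R0; lra)).
  now rewrite f0, !Rminus_0_r in flip. }
assert (fder1 : forall x, Rabs x < r -> Rabs (Derive f x) <= 1).
{ intros x hx. apply (lipschitz_derivative_bound f x _ 1 (d3 - Rabs x)); [lra| |].
  - apply Derive_correct, fder. lra.
  - intros h hh. pose proof (Rabs_triang x h).
    specialize (flip (x + h) x ltac:(lra) ltac:(lra)).
    replace (x + h - x) with h in flip by ring. lra. }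
assert (lipPQ : forall u v u' v',
  Rabs u < 2 * r -> Rabs v < 2 * r -> Rabs u' < 2 * r -> Rabs v' < 2 * r ->
  Rabs (Xfield A u v - Xfield A u' v') <= 2 * (Rabs (u - u') + Rabs (v - v')) /\
  Rabs (Yfield B u v - Yfield B u' v') <= 2 * (Rabs (u - u') + Rabs (v - v'))).
{ intros u v u' v' h1 h2 h3 h4. unfold Xfield, Yfield.
  specialize (lipA u v u' v' ltac:(lra) ltac:(lra) ltac:(lra) ltac:(lra)).
  specialize (lipB u v u' v' ltac:(lra) ltac:(lra) ltac:(lra) ltac:(lra)).
  pose proof (Rabs_pos (u - u')). pose proof (Rabs_pos (v - v')).
  split; [|lra].
  replace (v + A u v - (v' + A u' v')) with ((v - v') + (A u v - A u' v')) by ring.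
  pose proof (Rabs_triang (v - v') (A u v - A u' v')). lra. }
assert (growPQ : forall x y, Rabs x < 2 * r -> Rabs y < 2 * r ->
  Rabs (Xfield A x y) <= 2 * (Rabs x + Rabs y) /\
  Rabs (Yfield B x y) <= 2 * (Rabs x + Rabs y)).
{ intros x y hx hy.
  assert (h0 : Rabs 0 < 2 * r) by (rewrite Rabs_R0; lra).
  destruct (lipPQ x y 0 0 hx hy h0 h0) as [h1 h2].
  unfold Xfield, Yfield in *. rewrite A00 in h1. rewrite B00 in h2.
  rewrite Rplus_0_r, !Rminus_0_r in *. auto. }
assert (fieldsr : forall u v, Rabs u < r -> Rabs v < r ->
  ex_derive f u /\ Ufield A f u v = Xfield A u (f u + v) /\
  Vfield A B f u v = Yfield B u (f u + v) - Derive f u * Xfield A u (f u + v)).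
{ intros u v hu hv. split; [apply fder; lra|].
  pose proof (flin u hu). apply fields; try lra. apply fX. lra. }
assert (growUV : forall u v, Rabs u < r -> Rabs v < r ->
  Rabs (Ufield A f u v) <= 8 * (Rabs u + Rabs v) /\
  Rabs (Vfield A B f u v) <= 8 * (Rabs u + Rabs v)).
{ intros u v hu hv. destruct (fieldsr u v hu hv) as (_ & -> & ->).
  pose proof (flin u hu) as h1. pose proof (Rabs_triang (f u) v) as h2.
  destruct (growPQ u (f u + v)) as [h3 h4]; [lra|lra|].
  pose proof (Rabs_pos u). pose proof (Rabs_pos v).
  split; [lra|].
  pose proof (Rabs_triang (Yfield B u (f u + v)) (- (Derive f u * Xfield A u (f u + v)))) as h5.
  rewrite Rabs_Ropp, Rabs_mult in h5. unfold Rminus.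
  assert (h6 : Rabs (Derive f u) * Rabs (Xfield A u (f u + v))
    <= 1 * Rabs (Xfield A u (f u + v)))
    by (apply Rmult_le_compat_r; [apply Rabs_pos|now apply fder1]).
  lra. }
destruct (solution_trapped (Xfield A) (Yfield B) 2 (r / 2)) as (e1 & he1 & trapPQ);
  [lra|lra| |].
{ intros x y hx hy. apply growPQ; lra. }
destruct (solution_trapped (Ufield A f) (Vfield A B f) 8 r) as (e2 & he2 & trapUV);
  [lra|lra|exact growUV|].
apply locally_0_Rabs. exists (Rmin r (Rmin e1 e2)).
split; [repeat apply Rmin_glb_lt; auto|]. intros x0 hx0.
assert (hx0r : Rabs x0 < r) by (eapply Rlt_le_trans; [exact hx0|apply Rmin_l]).
assert (hx0e : Rabs x0 < e1 /\ Rabs x0 < e2).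
{ pose proof (Rmin_r r (Rmin e1 e2)). pose proof (Rmin_l e1 e2).
  pose proof (Rmin_r e1 e2). lra. }
pose proof (flin x0 hx0r) as hfx0.
apply fst_flow_eq.
- intros q hq. apply reaches_one_iff in hq.
  destruct hq as (x & y & hs & hp & _). injection hp as hx hy.
  assert (htr := trapPQ x y hs ltac:(rewrite hx; lra) ltac:(rewrite hy; lra)).
  exists (x 1, y 1 - f (x 1)). apply reaches_one_iff.
  exists x, (fun s => y s - f (x s)).
  split; [|split; [rewrite hx, hy; f_equal; ring|reflexivity]].
  apply (solves_straighten (Xfield A) (Yfield B) _ _ f r x y fieldsr); [|exact hs].
  intros s h. destruct (htr s h) as [h1 h2].
  pose proof (flin (x s) ltac:(lra)) as h3.
  pose proof (Rabs_triang (y s) (- f (x s))) as h4. rewrite Rabs_Ropp in h4.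
  unfold Rminus. split; lra.
- intros q' hq'. apply reaches_one_iff in hq'.
  destruct hq' as (u & v & hs & hp & <-). injection hp as hu hv.
  assert (htr := trapUV u v hs ltac:(rewrite hu; lra) ltac:(rewrite hv, Rabs_R0; lra)).
  exists (u 1, f (u 1) + v 1). split; [|reflexivity]. apply reaches_one_iff.
  exists u, (fun s => f (u s) + v s).
  split; [|split; [rewrite hu, hv; f_equal; ring|reflexivity]].
  apply (solves_unstraighten _ _ (Ufield A f) (Vfield A B f) f r u v fieldsr); assumption.
- intros q1 q2 h1 h2. apply reaches_one_iff in h1, h2.
  destruct h1 as (x & y & hs & hp & <-). destruct h2 as (x' & y' & hs' & hp' & <-).
  injection hp as hx hy. injection hp' as hx' hy'.
  destruct (solution_unique (Xfield A) (Yfield B) 2 (r / 2) x y x' y') as [-> ->];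
    auto; try congruence; try lra.
  + intros. apply lipPQ; lra.
  + apply trapPQ; [exact hs|rewrite hx; lra|rewrite hy; lra].
  + apply trapPQ; [exact hs'|rewrite hx'; lra|rewrite hy'; lra].
Qed.
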